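(* Let $n\in\mathbb{N}$, let $r_1,\dots,r_n>0$, let $K$ be a singular, strictly concave and (strictly) monotone kernel function, and let $J:[0,1]\to\mathbb{R}\cup\{-\infty\}$ be an upper semicontinuous $n$-field function. Then for nodes $\mathbf{x},\mathbf{y}\in Y$ majorization cannot hold, i.e., the coordinatewise inequality $\mathbf{m}(\mathbf{x})\le\mathbf{m}(\mathbf{y})$ (meaning $m_j(\mathbf{x})\le m_j(\mathbf{y})$ for all $j=0,1,\dots,n$) can only hold if $\mathbf{x}=\mathbf{y}$.
   Context: A kernel function is a function $K:(-1,0)\cup(0,1)\to\mathbb{R}$ that is concave on $(-1,0)$ and concave on $(0,1)$ and satisfies $\lim_{t\downarrow0}K(t)=\lim_{t\uparrow0}K(t)$. It is extended to $[-1,1]$, with values in $\mathbb{R}\cup\{-\infty\}$, by $K(0):=\lim_{t\to0}K(t)$, $K(-1):=\lim_{t\downarrow-1}K(t)$, $K(1):=\lim_{t\uparrow1}K(t)$. $K$ is singular if $K(0)=-\infty$; strictly concave if it is strictly concave on each of $(-1,0)$ and $(0,1)$; monotone if it is monotone decreasing on $(-1,0)$ and monotone increasing on $(0,1)$; strictly monotone if it is strictly decreasing on $[-1,0)$ and strictly increasing on $(0,1]$ (a strictly concave monotone kernel is strictly monotone). An $n$-field function is a function $J:[0,1]\to\mathbb{R}\cup\{-\infty\}$ that is bounded above and takes finite values at more than $n$ different points, where the points $0$ and $1$ are counted with weight $1/2$ and points of $(0,1)$ with weight $1$. Let $S:=\{\mathbf{y}=(y_1,\dots,y_n)\in(0,1)^n: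 0<y_1<\cdots<y_n<1\}$ and $\overline{S}:=\{\mathbf{y}\in[0,1]^n:0\le y_1\le\cdots\le y_n\le1\}$. For $\mathbf{y}\in\overline{S}$, $t\in[0,1]$ put $F(\mathbf{y},t):=J(t)+\sum_{j=1}^n r_jK(t-y_j)$. With $y_0:=0$, $y_{n+1}:=1$ put $I_j(\mathbf{y}):=[y_j,y_{j+1}]$ and $m_j(\mathbf{y}):=\sup_{t\in I_j(\mathbf{y})}F(\mathbf{y},t)$ for $j=0,1,\dots,n$, and $\mathbf{m}(\mathbf{y}):=(m_0(\mathbf{y}),\dots,m_n(\mathbf{y}))$. The regularity set is $Y:=\{\mathbf{y}\in S: m_j(\mathbf{y})\ne-\infty\text{ for }j=0,1,\dots,n\}$. *)

(* Defs.v *)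
From mathcomp Require Import all_boot all_order all_algebra.
From mathcomp Require Import all_classical all_reals all_analysis.

Set Implicit Arguments.
Unset Strict Implicit.
Unset Printing Implicit Defensive.

Import Order.TTheory GRing.Theory Num.Theory.
Import numFieldNormedType.Exports.

Local Open Scope classical_set_scope.
Local Open Scope ring_scope.

(* Functions on (-1,0) U (0,1) or on [0,1] are represented by total functions
   on R; their values outside the intended domain are never used. *)

Definition concave_on (R : realType) (D : set R) (f : R -> R) : Prop :=
  @convex_function R R^o D (fun t => - f t).

Definition strictly_concave_on (R : realType) (D : set R) (f : R -> R) : Prop :=
  forall s t a : R, D s -> D t -> s != t -> 0 < a < 1 ->
    a * f s + (1 - a) * f t < f (a * s + (1 - a) * t).

(* Limits are taken in \bar R, where by concavity both one-sided limits at 0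
   exist (and are different from +oo). *)
Definition kernel_function (R : realType) (K : R -> R) : Prop :=
  [/\ concave_on `]-1, 0[ K, concave_on `]0, 1[ K &
      lim ((K t)%:E @[t --> 0^'+]) = lim ((K t)%:E @[t --> 0^'-])].

(* The extension of the kernel function K to [-1,1]. *)
Definition kernel_ext (R : realType) (K : R -> R) (t : R) : \bar R :=
  if t == 0 then lim ((K s)%:E @[s --> 0^'])
  else if t == -1 then lim ((K s)%:E @[s --> (-1)^'+])
  else if t == 1 then lim ((K s)%:E @[s --> 1^'-])
  else (K t)%:E.

Definition singular_kernel (R : realType) (K : R -> R) : Prop :=
  kernel_ext K 0 = -oo%E.

Definition strictly_concave_kernel (R : realType) (K : R -> R) : Prop :=
  strictly_concave_on `]-1, 0[ K /\ strictly_concave_on `]0, 1[ K.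

Definition monotone_kernel (R : realType) (K : R -> R) : Prop :=
  {in `]-1, 0[ &, forall s t, s <= t -> K t <= K s} /\
  {in `]0, 1[ &, forall s t, s <= t -> K s <= K t}.

Definition point_weight (R : realType) (t : R) : R :=
  if (t == 0) || (t == 1) then 2^-1 else 1.

(* Boundedness above rules out the value +oo on [0,1]. *)
Definition field_function (R : realType) (n : nat) (J : R -> \bar R) : Prop :=
  (exists M : R, forall t, t \in `[0, 1] -> (J t <= M%:E)%E) /\
  (n%:R%:E < \esum_(t in [set t | t \in `[0%R, 1%R] /\ J t \is a fin_num])
               (point_weight t)%:E)%E.

(* Upper semicontinuity with respect to the subspace topology of A. *)
Definition upper_semicontinuous_on (R : realType) (A : set R)
    (J : R -> \bar R) : Prop :=
  @lower_semicontinuous (subspace A) R (fun t => - J t)%E.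

Definition open_simplex (R : realType) (n : nat) : set 'rV[R]_n :=
  [set y | (forall j : 'I_n, 0 < y ord0 j < 1) /\
           (forall i j : 'I_n, (i < j)%N -> y ord0 i < y ord0 j)].

(* node y 0 = 0, node y k = y_k for 1 <= k <= n (which is the entry of index
   k - 1 of y), and node y n.+1 = 1. *)
Definition node (R : realType) (n : nat) (y : 'rV[R]_n) (k : nat) : R :=
  if k is k'.+1 then
    if (insub k' : option 'I_n) is Some i then y ord0 i else 1
  else 0.

Definition sum_translates (R : realType) (n : nat) (r : 'I_n -> R)
    (K : R -> R) (J : R -> \bar R) (y : 'rV[R]_n) (t : R) : \bar R :=
  (J t + \sum_(j < n) (r j)%:E * kernel_ext K (t - y ord0 j)%R)%E.

Definition interval_max (R : realType) (n : nat) (r : 'I_n -> R)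
    (K : R -> R) (J : R -> \bar R) (y : 'rV[R]_n) (j : 'I_n.+1) : \bar R :=
  ereal_sup [set sum_translates r K J y t | t in `[node y j, node y j.+1]].

Definition regularity_set (R : realType) (n : nat) (r : 'I_n -> R)
    (K : R -> R) (J : R -> \bar R) : set 'rV[R]_n :=
  [set y | open_simplex y /\ forall j, interval_max r K J y j != -oo%E].

(* Main.v *)
Require Import Defs.
From mathcomp Require Import all_boot all_order all_algebra.
From mathcomp Require Import all_classical all_reals all_analysis.
From mathcomp Require Import ring lra.

(** Suppose that [x] and [y] are different, and let
    [U_k = \sum_(1 <= i <= k) r_i * (y_i - x_i)] be the weighted displacement
    of the first [k] nodes when [x] is moved to [y]. Choose an index [j] among
    [0, ..., n] at which [U] is largest. Then [m_j(y) < m_j(x)], so that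
    [m(x) <= m(y)] fails.

    The maximality of [U_j] forces [x_j <= y_j] and [y_{j+1} <= x_{j+1}]: the
    interval [I_j(y)] is contained in [I_j(x)]. Moreover
    [F(y, t) < F(x, t)] for all [t] in [I_j(y)] at which [F(y, t)] is finite.
    To see this, take for each node a supergradient [g_i] of [K] at [t - x_i].
    By strict concavity, [F(y, t) - F(x, t) < - \sum_i g_i * (U_i - U_{i-1})]
    ([strict_supergradient], [weighted_sum_lt]). By concavity, [g_i] increases
    with [i] on either side of [t]; by monotonicity of [K], it is nonnegative
    for the nodes to the left of [t] and nonpositive for those to the right.
    Extended by [0] at both ends, the sequence [g] thus increases except for a
    drop between the nodes surrounding [t], which is exactly at the index [j].
    Summing by parts ([abel_sum_ge0]) multiplies each increment of [g] by a gap
    [U_j - U_k >= 0], and this gap vanishes where [g] drops; hence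
    [\sum_i g_i * (U_i - U_{i-1}) >= 0].

    The pointwise strict inequality passes to the suprema because [F(y, .)]
    attains its supremum on [I_j(y)]: it is upper semicontinuous, since [J] is,
    and since [K] lies below its tangents and tends to [-oo] at its singularity
    ([usc_sum_translates], [usc_attains_max]). *)

Set Implicit Arguments.
Unset Strict Implicit.
Unset Printing Implicit Defensive.

Import Order.TTheory GRing.Theory Num.Theory.
Import numFieldNormedType.Exports.

Local Open Scope classical_set_scope.
Local Open Scope ring_scope.

(** * Summation by parts *)

(** Summation by parts turns the sum into a combination of the nonnegative
    gaps [U j - U k], with the increments of [g], extended by [0] at both ends,
    as coefficients. The one increment whose sign is not known, at the index
    [j] where [g] may drop from positive to negative values, is multiplied by
    the gap [U j - U j = 0]. *)
Lemma abel_sum_ge0 (R : realDomainType) (n j : nat) (U g : nat -> R) :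
    (forall k, (k <= n)%N -> U k <= U j) ->
    ((0 < j)%N -> 0 <= g 0%N) ->
    ((j < n)%N -> g n.-1 <= 0) ->
    (forall k, (k.+1 < n)%N -> k.+1 != j -> g k <= g k.+1) ->
  (j <= n)%N -> 0 <= \sum_(i < n) g i * (U i.+1 - U i).
Proof.
move=> Umax g0 gn gmon jn.
case: n => [|n] in Umax gn gmon jn *; first by rewrite big_ord0.
(* The last term is the boundary term left by summing the first [m.+1] terms by
   parts. *)
have main m : (m <= n)%N ->
    0 <= \sum_(i < m.+1) g i * (U i.+1 - U i) + g m * (U j - U m.+1).
  elim: m => [_|m IHm mn].
    rewrite big_ord1 -mulrDr addrC subrKA.
    have [->|j0] := posnP j; first by rewrite subrr mulr0.
    by rewrite mulr_ge0 ?g0// subr_ge0 Umax.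
  have IH := IHm (ltnW mn).
  rewrite big_ord_recr /= -addrA -mulrDr.
  rewrite [U _ - _ + _]addrC subrKA.
  rewrite (le_trans IH)// lerD2l.
  have [<-|jm] := eqVneq m.+1 j; first by rewrite subrr !mulr0.
  by rewrite ler_wpM2r ?gmon// subr_ge0 Umax// ltnW.
apply: (le_trans (main n (leqnn n))); rewrite gerDl.
move: jn; rewrite leq_eqVlt => /predU1P[->|jn]; first by rewrite subrr mulr0.
by rewrite mulr_le0_ge0 ?gn// subr_ge0 Umax.
Qed.

(** * Supergradients of strictly concave functions *)

(** The right derivative of [f], that is, the supremum of the slopes of the
    chords to the right of a point, is a supergradient. Strictness follows
    from the non-strict inequality at the midpoint of [s] and [u]. *)
Lemma strict_supergradient (R : realType) (a b : R) (f : R -> R) :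
    strictly_concave_on `]a, b[ f ->
  exists g : R -> R, forall s u, s \in `]a, b[ -> u \in `]a, b[ -> u != s ->
    f u < f s + g s * (u - s).
Proof.
move=> cf.
pose S s : set R :=
  (fun u => (f u - f s) / (u - s)) @` [set u | (u \in `]a, b[) /\ s < u].
have slopes s u v : v \in `]a, b[ -> u \in `]a, b[ -> v < s -> s < u ->
    (f u - f s) / (u - s) <= (f v - f s) / (v - s).
  move=> vab uab vs su.
  have uv : 0 < u - v by lra.
  have /= := cf v u ((u - s) / (u - v)) vab uab.
  have -> : (u - s) / (u - v) * v + (1 - (u - s) / (u - v)) * u = s.
    by field; lra.
  have -> : 1 - (u - s) / (u - v) = (s - v) / (u - v) by field; lra.
  rewrite lt_eqF ?(lt_trans vs su)// divr_gt0 ?ltr_pdivrMr ?mul1r; try lra.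
  have -> : u - s < u - v by lra.
  move=> /(_ isT isT).
  rewrite mulrAC [X in _ + X]mulrAC -mulrDl ltr_pdivrMr// => h.
  have -> : (f v - f s) / (v - s) = (f s - f v) / (s - v) by field; lra.
  rewrite ler_pdivrMr ?subr_gt0// [leRHS]mulrAC ler_pdivlMr ?subr_gt0//.
  by nra.
exists (fun s => sup (S s)).
(* Chord slopes to the left of [s] bound those to its right from above: this
   makes the supremum finite, and handles the points [u] to the left of [s]. *)
have weak s u : s \in `]a, b[ -> u \in `]a, b[ -> u != s ->
    f u <= f s + sup (S s) * (u - s).
  move=> sab uab us.
  have [asb] : a < s < b /\ a < u < b by move: sab uab; rewrite !in_itv/=.
  move=> aub.
  rewrite -lerBlDl.
  have S0 : S s !=set0.
    exists ((f ((s + b) / 2) - f s) / ((s + b) / 2 - s)).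
    by exists ((s + b) / 2) => //=; rewrite in_itv/=; split; lra.
  case: (ltgtP u s) us => // us _.
    rewrite -ler_ndivlMr ?subr_lt0//; apply: ge_sup => //.
    by move=> _ [w [wab sw] <-]; exact: slopes.
  rewrite -ler_pdivrMr ?subr_gt0//; apply: ub_le_sup; last by exists u.
  exists ((f ((s + a) / 2) - f s) / ((s + a) / 2 - s)).
  by move=> _ [w [wab sw] <-]; apply: slopes => //; rewrite ?in_itv/=; lra.
move=> s u sab uab us.
have mab : (s + u) / 2 \in `]a, b[.
  by move: sab uab; rewrite !in_itv/=; lra.
have ms : (s + u) / 2 != s by apply: contra us => /eqP ?; apply/eqP; lra.
have h1 := weak _ _ sab mab ms.
have := cf s u 2^-1 sab uab.
rewrite eq_sym us => /(_ isT).
rewrite (_ : 2^-1 * s + (1 - 2^-1) * u = (s + u) / 2); last by field.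
have -> : 0 < (2^-1 : R) < 1 by lra.
move=> /(_ isT).
rewrite (_ : (s + u) / 2 - s = (u - s) / 2) in h1; last by field.
by lra.
Qed.

Lemma supergradient_le (R : realType) (a b : R) (f g : R -> R) :
    (forall s u, s \in `]a, b[ -> u \in `]a, b[ -> u != s ->
      f u < f s + g s * (u - s)) ->
  {in `]a, b[ &, forall s u, s <= u -> g u <= g s}.
Proof.
move=> gf s u sab uab; rewrite le_eqVlt => /predU1P[->//|su].
have := gf s u sab uab; rewrite gt_eqF// => /(_ isT) h1.
have := gf u s uab sab; rewrite lt_eqF// => /(_ isT) h2.
have : 0 < (g s - g u) * (u - s) by nra.
by rewrite pmulr_lgt0 ?subr_gt0// => /ltW.
Qed.

(** * Comparison of sums of translates at a point *)

(** The supergradients [g i] of [K] at [t - x i] bound the left side minus the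
    right side strictly from above by [\sum_i g i * (r i * (x i - y i))]. As
    [K] is concave and monotone on both sides of its singularity, the [g i] are
    nonnegative and increasing over the nodes to the left of [t], nonpositive
    and increasing over the nodes to its right. They can only drop at the index
    [j], where the weighted displacement [U j] of the first [j] nodes is
    largest, so [abel_sum_ge0] applies. *)
Lemma weighted_sum_lt (R : realType) (n j : nat) (r : 'I_n -> R)
    (K : R -> R) (x y : 'I_n -> R) (t : R)
    (U := fun k => \sum_(i < n | (i < k)%N) r i * (y i - x i)) :
    (forall i, 0 < r i) -> strictly_concave_kernel K -> monotone_kernel K ->
    (j <= n)%N -> (forall k, (k <= n)%N -> U k <= U j) ->
    (forall i k : 'I_n, (i < k)%N -> x i < x k) ->
    (forall i : 'I_n, (i < j)%N -> 0 < t - x i < 1 /\ 0 < t - y i < 1) ->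
    (forall i : 'I_n, (j <= i)%N -> -1 < t - x i < 0 /\ -1 < t - y i < 0) ->
    (exists i, y i != x i) ->
  \sum_i r i * K (t - y i) < \sum_i r i * K (t - x i).
Proof.
move=> r0 [Kneg Kpos] [Kdec Kinc] jn Umax xinc left_t right_t [i0 xy0].
have [gp gpK] := strict_supergradient Kpos.
have [gn gnK] := strict_supergradient Kneg.
have gp_ge0 s : s \in `]0, 1[ -> 0 <= gp s.
  move=> s01; have := s01; rewrite in_itv/= => s01'.
  have u01 : (s + 1) / 2 \in `]0, 1[ by rewrite in_itv/=; lra.
  have su : s < (s + 1) / 2 by lra.
  have := gpK _ _ s01 u01; rewrite gt_eqF// => /(_ isT).
  have := Kinc _ _ s01 u01 (ltW su) => h1 h2.
  have : 0 < gp s * ((s + 1) / 2 - s) by lra.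
  by rewrite pmulr_lgt0 ?subr_gt0// => /ltW.
have gn_le0 s : s \in `]-1, 0[ -> gn s <= 0.
  move=> s01; have := s01; rewrite in_itv/= => s01'.
  have u01 : (s - 1) / 2 \in `]-1, 0[ by rewrite in_itv/=; lra.
  have su : (s - 1) / 2 < s by lra.
  have := gnK _ _ s01 u01; rewrite lt_eqF// => /(_ isT).
  have := Kdec _ _ u01 s01 (ltW su) => h1 h2.
  have : 0 < gn s * ((s - 1) / 2 - s) by lra.
  by rewrite nmulr_lgt0 ?subr_lt0// => /ltW.
pose g (i : 'I_n) := if (i < j)%N then gp (t - x i) else gn (t - x i).
have grad_lt i : y i != x i -> K (t - y i) < K (t - x i) + g i * (x i - y i).
  move=> yx.
  have e : x i - y i = t - y i - (t - x i) by ring.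
  have ne : t - y i != t - x i.
    by apply: contra yx => /eqP h; apply/eqP; lra.
  rewrite /g e; case: ltnP => ij.
    by have [? ?] := left_t _ ij; apply: gpK; rewrite ?in_itv.
  by have [? ?] := right_t _ ij; apply: gnK; rewrite ?in_itv.
have grad_le i : K (t - y i) <= K (t - x i) + g i * (x i - y i).
  have [->|yx] := eqVneq (y i) (x i); first by rewrite subrr mulr0 addr0.
  exact/ltW/grad_lt.
have abel : 0 <= \sum_i g i * (r i * (y i - x i)).
  (* [abel_sum_ge0] takes sequences indexed by [nat]. *)
  pose gg k := if insub k is Some i then g i else 0.
  have ggE i : gg (val i) = g i by rewrite /gg valK.
  have UE (i : 'I_n) : U i.+1 - U i = r i * (y i - x i).
    rewrite /U (bigD1 i)//= [X in _ + X - _](eq_bigl (fun k : 'I_n => k < i)%N).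
      by rewrite addrK.
    by move=> k; rewrite ltnS ltn_neqAle andbC -val_eqE.
  have -> : \sum_i g i * (r i * (y i - x i)) =
      \sum_(i < n) gg i * (U i.+1 - U i).
    by apply: eq_bigr => i _; rewrite UE ggE.
  apply: (@abel_sum_ge0 _ _ j) => //.
  - move=> j0; have n0 : (0 < n)%N by apply: leq_trans jn.
    rewrite -[0%N]/(val (Ordinal n0)) ggE /g /= j0 gp_ge0// in_itv/=.
    exact: (left_t (Ordinal n0) j0).1.
  - move=> j_n; have n1 : (n.-1 < n)%N by rewrite ltn_predL (leq_trans _ j_n).
    have jn1 : (j <= n.-1)%N by rewrite -ltnS prednK// (leq_trans _ j_n).
    rewrite -[n.-1]/(val (Ordinal n1)) ggE /g /= ltnNge jn1 /=.
    rewrite gn_le0// in_itv/=.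
    exact: (right_t (Ordinal n1) jn1).1.
  - move=> k k1n k1j; have kn := ltnW k1n.
    rewrite -[k]/(val (Ordinal kn)) -[(val _).+1]/(val (Ordinal k1n)).
    rewrite !ggE /g /=.
    have tx : t - x (Ordinal k1n) <= t - x (Ordinal kn).
      by have := xinc (Ordinal kn) (Ordinal k1n) (ltnSn k); lra.
    case: ltnP => kj; last first.
      rewrite ltnNge ltnW ?ltnS//=.
      apply: (supergradient_le gnK) => //; rewrite in_itv/=.
        exact: (right_t (Ordinal k1n) (leqW kj)).1.
      exact: (right_t (Ordinal kn) kj).1.
    have kj1 : (k.+1 < j)%N by rewrite ltn_neqAle k1j.
    rewrite kj1; apply: (supergradient_le gpK) => //; rewrite in_itv/=.
      exact: (left_t (Ordinal k1n) kj1).1.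
    exact: (left_t (Ordinal kn) kj).1.
apply: (@lt_le_trans _ _
    (\sum_i (r i * K (t - x i) - g i * (r i * (y i - x i))))); last first.
  by rewrite sumrB gerBl.
rewrite (bigD1 i0)//= [ltRHS](bigD1 i0)//=; apply: ltr_leD.
  by move: (grad_lt _ xy0); rewrite -(ltr_pM2l (r0 i0) (K _)); lra.
apply: ler_sum => i _.
by have := grad_le i; rewrite -(ler_pM2l (r0 i) (K _)); lra.
Qed.

(** * Upper semicontinuous functions *)

(** Upper semicontinuity at one point along a filter [F], so that [F] can be a
    full neighbourhood filter for the kernel and a filter of neighbourhoods
    within [[0, 1]] for the field function. *)
Definition usc_along (T : Type) (R : realType) (F : set_system T)
    (f : T -> \bar R) (t : T) : Prop :=
  forall a : R, (f t < a%:E)%E -> \forall s \near F, (f s < a%:E)%E.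

Lemma usc_alongD (T : Type) (R : realType) (F : set_system T) (FF : Filter F)
    (f g : T -> \bar R) (t : T) :
    (f t < +oo)%E -> (g t < +oo)%E ->
    usc_along F f t -> usc_along F g t ->
  usc_along F (fun s => f s + g s)%E t.
Proof.
move=> ft gt uf ug a fga.
have [b [c [fb gc <-]]] :
    exists b c : R, [/\ (f t < b%:E)%E, (g t < c%:E)%E & b + c = a].
  move: (f t) (g t) ft gt fga => [p| |] [q| |] //= _ _.
  - rewrite -EFinD !lte_fin => h.
    exists (p + (a - p - q) / 2), (q + (a - p - q) / 2).
    by rewrite !lte_fin; split; lra.
  - by exists (p + 1), (a - (p + 1)); rewrite !lte_fin ltNyr; split=> //; lra.
  - by exists (a - (q + 1)), (q + 1); rewrite !lte_fin ltNyr; split=> //; lra.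
  - by exists 0, a; rewrite !ltNyr add0r.
near=> s; rewrite EFinD lteD//.
- by near: s; exact: uf.
- by near: s; exact: ug.
Unshelve. all: by end_near. Qed.

Lemma usc_along_sum (T : Type) (R : realType) (F : set_system T)
    (FF : Filter F) (I : Type) (js : seq I) (f : I -> T -> \bar R) (t : T) :
    (forall j, (f j t < +oo)%E) -> (forall j, usc_along F (f j) t) ->
  usc_along F (fun s => \sum_(j <- js) f j s)%E t.
Proof.
move=> foo uf.
suff [] : (\sum_(j <- js) f j t < +oo)%E /\
    usc_along F (fun s => \sum_(j <- js) f j s)%E t by [].
elim: js => [|j js [IHoo IHu]].
  rewrite big_nil ltry; split=> // a; rewrite big_nil => a0.
  by near=> s; rewrite big_nil.
rewrite big_cons lte_add_pinfty//; split=> // a.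
rewrite big_cons => h.
have := usc_alongD FF (foo j) IHoo (uf j) IHu h.
by apply: filterS => s; rewrite big_cons.
Unshelve. all: by end_near. Qed.

Lemma exists_fin_between (R : realType) (x y : \bar R) :
  (x < y)%E -> exists a : R, (x < a%:E)%E /\ (a%:E < y)%E.
Proof.
case: x y => [p| |] [q| |] // h.
- rewrite lte_fin in h.
  by exists ((p + q) / 2); rewrite !lte_fin; split; lra.
- by exists (p + 1); rewrite lte_fin ltry; split=> //; lra.
- by exists (q - 1); rewrite lte_fin ltNyr; split=> //; lra.
- by exists 0; rewrite ltNyr ltry.
Qed.

(** If the supremum were not attained, each point would have a neighbourhood
    on which [f] stays below some level smaller than the supremum. By
    compactness one such level would serve for all of [A]. The levels tend to
    the supremum along a filter that depends on whether it is finite. *)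
Lemma usc_attains_max (T : topologicalType) (R : realType) (A : set T)
    (f : T -> \bar R) :
    compact A -> A !=set0 ->
    (forall t, A t -> usc_along (within A (nbhs t)) f t) ->
  exists2 t, A t & ereal_sup (f @` A) = f t.
Proof.
move=> cA [t0 At0] uf; apply: contrapT => noatt.
have lt_sup t : A t -> (f t < ereal_sup (f @` A))%E.
  move=> At; rewrite lt_neqAle ereal_sup_ubound ?andbT; last by exists t.
  by apply/eqP => e; apply: noatt; exists t.
have covered (F : set_system R) : ProperFilter F ->
    (forall a : R, (a%:E < ereal_sup (f @` A))%E ->
      \forall c \near F, a <= c) ->
    (\forall c \near F, (c%:E < ereal_sup (f @` A))%E) -> False.
  move=> FF Fge Flt.
  move/compact_near_coveringP : cA => cA.
  have := cA R F (fun c t => A t -> (f t <= c%:E)%E) _.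
  have loc t : A t -> \near t & F, A t -> (f t <= F%:E)%E.
    move=> At.
    have [a [fa asup]] : exists a : R,
        (f t < a%:E)%E /\ (a%:E < ereal_sup (f @` A))%E.
      exact/exists_fin_between/lt_sup.
    have := uf _ At _ fa; rewrite /within/= => near_t.
    exists ([set s | A s -> (f s < a%:E)%E], [set c | a <= c]).
      by split=> //=; exact: Fge.
    move=> [s c] /= [sa ac] As; rewrite (le_trans (ltW (sa As)))//.
  move=> /(_ _ loc) H.
  have [c [/= cge csup]] := filter_ex (filterI H Flt).
  have := csup; rewrite ltNge => /negP; apply; apply: ge_ereal_sup.
  by move=> _ [s As <-]; exact: (cge _ As As).
have := lt_sup _ At0.
case E : (ereal_sup (f @` A)) => [m| |]; last by rewrite ltNge leNye.
- move=> _; apply: (covered m^'-); rewrite E.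
  + by move=> a; rewrite lte_fin => am; near=> c; apply: ltW; near: c;
      exact: nbhs_left_gt.
  + by near=> c; rewrite lte_fin; near: c; exact: nbhs_left_lt.
- move=> _; apply: (covered +oo); rewrite E.
  + by move=> a _; near=> c; apply: ltW; near: c; apply: nbhs_pinfty_gt;
      exact: num_real.
  + by near=> c; rewrite ltry.
Unshelve. all: try by end_near. Qed.

Lemma usc_along_translate (R : realType) (f : R -> \bar R) (y t : R) :
    usc_along (nbhs (t - y)) f (t - y) ->
  usc_along (nbhs t) (fun s => f (s - y)) t.
Proof.
move=> uf a fa.
have c : (fun s : R => s - y) s @[s --> t] --> t - y.
  by apply: cvgB; [exact: cvg_id|exact: cvg_cst].
exact: c _ (uf a fa).
Qed.

Lemma usc_along_scale (T : Type) (R : realType) (F : set_system T)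
    (FF : Filter F) (r : R) (f : T -> \bar R) (t : T) :
  0 < r -> usc_along F f t -> usc_along F (fun s => r%:E * f s)%E t.
Proof.
move=> r0 uf a; rewrite -lte_pdivlMl// -EFinM => h.
by near=> s; rewrite -lte_pdivlMl// -EFinM; near: s; exact: uf.
Unshelve. all: by end_near. Qed.

(** * Nodes *)

Lemma node_ord (R : realType) (n : nat) (y : 'rV[R]_n) (i : 'I_n) :
  node y i.+1 = y ord0 i.
Proof. by rewrite /node valK. Qed.

Lemma node_last (R : realType) (n : nat) (y : 'rV[R]_n) : node y n.+1 = 1.
Proof. by rewrite /node insubN// ltnn. Qed.

Lemma node_mono (R : realType) (n : nat) (y : 'rV[R]_n) (i j : nat) :
  open_simplex y -> (i <= j <= n.+1)%N -> node y i <= node y j.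
Proof.
move=> [y01 yinc] /andP[].
case: i j => [|i] [|j] //=; rewrite ?lexx//.
  move=> _ _; case: insubP => [j' _ _|_]; last by [].
  by have /andP[/ltW] := y01 j'.
rewrite !ltnS => ij jn.
case: (insubP _ j) => [j' _ jE|_]; last first.
  by case: insubP => [i' _ _|_] //; have /andP[_ /ltW] := y01 i'.
have iP : (i < n)%N by apply: (leq_ltn_trans ij); rewrite -jE ltn_ord.
case: (insubP _ i) => [i' _ iE|]; last by rewrite iP.
move: ij; rewrite leq_eqVlt => /predU1P[ij|ij].
  by rewrite (_ : i' = j')//; apply: val_inj; rewrite iE jE.
by apply/ltW/yinc; rewrite iE jE.
Qed.

Lemma node_itv (R : realType) (n : nat) (y : 'rV[R]_n) (i : nat) :
  open_simplex y -> (i <= n.+1)%N -> 0 <= node y i <= 1.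
Proof.
move=> yS i_n; have /= -> := @node_mono _ _ y 0 i yS i_n.
by have := @node_mono _ _ y i n.+1 yS; rewrite node_last i_n leqnn => ->.
Qed.

(** * Sums of translates of a singular kernel *)

(** The limit of a filter that does not converge is the default value [0], so
    a limit equal to [-oo] is a genuine one. *)
Lemma singular_kernelE (R : realType) (K : R -> R) :
  singular_kernel K -> (K s)%:E @[s --> 0^'] --> -oo%E.
Proof.
rewrite /singular_kernel /kernel_ext eqxx /lim /lim_in/=.
case: xgetP => [l _ cvl <-|//].
exact: cvl.
Qed.

Lemma kernel_ext_inE (R : realType) (K : R -> R) (s : R) :
  s != 0 -> -1 < s < 1 -> kernel_ext K s = (K s)%:E.
Proof.
by move=> s0 /andP[s1 s2]; rewrite /kernel_ext (negbTE s0) gt_eqF// lt_eqF.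
Qed.

(** At [0] this is the singularity of [K]; elsewhere [K] lies below an affine
    function with the same value at [s], given by a supergradient. *)
Lemma usc_kernel_ext (R : realType) (K : R -> R) (s : R) :
    singular_kernel K -> strictly_concave_kernel K -> -1 < s < 1 ->
  usc_along (nbhs s) (kernel_ext K) s.
Proof.
move=> Ks [cneg cpos] s1 a.
have [->|s0] := eqVneq s 0.
  move=> _.
  have /cvgeNyPlt/(_ a) := singular_kernelE Ks.
  rewrite near_withinE => near0.
  near=> u.
  have [->|u0] := eqVneq u 0; first by rewrite Ks ltNyr.
  rewrite kernel_ext_inE//; first by move: u0; near: u; exact: near0.
  by near: u; apply: near_in_itvoo; rewrite in_itv/=; lra.
rewrite kernel_ext_inE// lte_fin => Ksa.
have main (b c : R) : -1 <= b -> c <= 1 -> ~~ (b < 0 < c) ->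
    strictly_concave_on `]b, c[ K -> s \in `]b, c[ ->
    \forall u \near nbhs s, (kernel_ext K u < a%:E)%E.
  move=> b1 c1 bc cK sbc.
  have [g gK] := strict_supergradient cK.
  have aff : K s + g s * (u - s) @[u --> s] --> K s + g s * (s - s).
    apply: cvgD; first exact: cvg_cst.
    apply: cvgM; first exact: cvg_cst.
    by apply: cvgB; [exact: cvg_id|exact: cvg_cst].
  rewrite subrr mulr0 addr0 in aff.
  near=> u.
  have ubc : u \in `]b, c[ by near: u; exact: near_in_itvoo.
  have u1 : b < u < c by rewrite in_itv/= in ubc.
  rewrite kernel_ext_inE//; last 2 first.
  - by apply: contraNneq bc => u0; rewrite u0 in u1.
  - by lra.
  rewrite lte_fin; have [->//|us] := eqVneq u s.
  apply: (lt_trans (gK _ _ sbc ubc us)).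
  by near: u; exact: (cvgr_lt _ aff).
have [s0'|s0'] := ltP s 0.
- by apply: (main (-1) 0) => //; rewrite ?in_itv/=; lra.
- by apply: (main 0 1) => //; rewrite ?in_itv/=; lra.
Unshelve. all: by end_near. Qed.

Lemma kernel_ext_lty (R : realType) (K : R -> R) (s : R) :
  singular_kernel K -> -1 < s < 1 -> (kernel_ext K s < +oo)%E.
Proof.
move=> Ks s1; have [->|s0] := eqVneq s 0; first by rewrite Ks.
by rewrite kernel_ext_inE// ltry.
Qed.

Lemma usc_along_subspace (R : realType) (A : set R) (J : R -> \bar R) (t : R) :
  upper_semicontinuous_on A J -> A t -> usc_along (within A (nbhs t)) J t.
Proof.
move=> uJ At a Jt.
have [|V] := uJ t (- a); first by rewrite EFinN lteN2.
rewrite /nbhs/= -nbhs_subspace_in//.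
move=> Vt VJ.
apply: filterS Vt => s /VJ.
by rewrite EFinN lteN2.
Qed.

Lemma usc_sum_translates (R : realType) (n : nat) (r : 'I_n -> R) (K : R -> R)
    (J : R -> \bar R) (y : 'rV[R]_n) (t : R) :
    (forall j, 0 < r j) -> singular_kernel K -> strictly_concave_kernel K ->
    upper_semicontinuous_on `[0, 1] J ->
    (forall j, 0 < y ord0 j < 1) -> t \in `[0, 1] -> (J t < +oo)%E ->
  usc_along (within `[0, 1] (nbhs t)) (sum_translates r K J y) t.
Proof.
move=> r0 Ks Kc uJ y01 t01 Jt.
have ty j : -1 < t - y ord0 j < 1.
  by have := y01 j; move: t01; rewrite in_itv/=; lra.
have Klty j : ((r j)%:E * kernel_ext K (t - y ord0 j) < +oo)%E.
  by rewrite lte_mul_pinfty ?lee_fin ?(ltW (r0 j))// kernel_ext_lty.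
apply: usc_alongD.
- exact: Jt.
- by apply: lte_sum_pinfty => j _; exact: Klty.
- exact: usc_along_subspace.
apply: (@usc_along_sum _ _ _ _ _ _
  (fun j s => (r j)%:E * kernel_ext K (s - y ord0 j))%E) => // j.
apply: usc_along_scale => // a Ka.
apply: cvg_within; move: a Ka.
exact/usc_along_translate/usc_kernel_ext.
Qed.

Lemma sum_translatesE (R : realType) (n : nat) (r : 'I_n -> R) (K : R -> R)
    (J : R -> \bar R) (y : 'rV[R]_n) (t : R) :
    (forall j, t - y ord0 j != 0) -> (forall j, -1 < t - y ord0 j < 1) ->
  sum_translates r K J y t = (J t + (\sum_j r j * K (t - y ord0 j))%:E)%E.
Proof.
move=> t0 t1; rewrite /sum_translates -sumEFin; congr (_ + _)%E.
by apply: eq_bigr => j _; rewrite kernel_ext_inE.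
Qed.

Lemma sum_translates_node (R : realType) (n : nat) (r : 'I_n -> R) (K : R -> R)
    (J : R -> \bar R) (y : 'rV[R]_n) (j : 'I_n) :
    (forall j, 0 < r j) -> singular_kernel K ->
  sum_translates r K J y (y ord0 j) = -oo%E.
Proof.
move=> r0 Ks; rewrite /sum_translates (bigD1 j)//= subrr Ks.
by rewrite gt0_muleNy ?lte_fin// addNye addeNy.
Qed.

(** * Maxima on the intervals between nodes *)

Theorem theorem4p1 (R : realType) (n : nat) (r : 'I_n -> R)
    (K : R -> R) (J : R -> \bar R)
    (r_gt0 : forall j, 0 < r j)
    (K_kernel : kernel_function K)
    (K_singular : singular_kernel K)
    (K_strictly_concave : strictly_concave_kernel K)
    (K_monotone : monotone_kernel K)
    (J_field : field_function n J)
    (J_usc : upper_semicontinuous_on `[0, 1] J)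
    (x y : 'rV[R]_n)
    (xY : regularity_set r K J x)
    (yY : regularity_set r K J y)
    (m_le : forall j : 'I_n.+1,
      (interval_max r K J x j <= interval_max r K J y j)%E) :
  x = y.
Proof.
move: xY yY => [xS _] [yS yfin].
have [[M JM] _] := J_field.
have Jlty t : t \in `[0, 1] -> (J t < +oo)%E.
  by move=> t01; rewrite (le_lt_trans (JM _ t01))// ltry.
have [y01 yinc] := yS; have [x01 xinc] := xS.
apply: contrapT => xy.
have [i0 yx0] : exists i, y ord0 i != x ord0 i.
  apply: contrapT => h; apply: xy; apply/rowP => i.
  by apply/eqP; rewrite eq_sym; apply: contraT => yx; case: h; exists i.
pose U k := \sum_(i < n | (i < k)%N) r i * (y ord0 i - x ord0 i).
have US (i : 'I_n) : U i.+1 = r i * (y ord0 i - x ord0 i) + U i.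
  rewrite /U (bigD1 i)//=; congr (_ + _); apply: eq_bigl => k.
  by rewrite ltnS ltn_neqAle andbC -val_eqE.
pose j := [arg max_(k > (ord0 : 'I_n.+1)) U k]%O.
have Umax k : (k <= n)%N -> U k <= U j.
  rewrite -ltnS => kn; rewrite /j; case: arg_maxP => // i _ h.
  exact: (h (Ordinal kn)).
have jn : (j <= n)%N by rewrite -ltnS ltn_ord.
(* Since [U] is largest at [j], its last increment is nonnegative and its next
   one nonpositive, so the interval of index [j] for [y] lies in that for
   [x]. *)
have node_l : node x j <= node y j.
  case: (nat_of_ord j) jn Umax => [//|k] kn Umax'.
  rewrite -[k]/(val (Ordinal kn)) !node_ord -subr_ge0.
  rewrite -(pmulr_rge0 _ (r_gt0 (Ordinal kn))) -(lerDr (U k)) -US.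
  exact/Umax'/ltnW.
have node_r : node y j.+1 <= node x j.+1.
  move: jn; rewrite leq_eqVlt => /predU1P[->|j_n]; first by rewrite !node_last.
  rewrite -[nat_of_ord j]/(val (Ordinal j_n)) !node_ord -subr_le0.
  rewrite -(pmulr_rle0 _ (r_gt0 (Ordinal j_n))) -(gerDr (U j)) -US.
  exact: Umax.
have itv_sub t : t \in `[node y j, node y j.+1] -> t \in `[0, 1].
  have /andP[y0 _] := node_itv yS (leqW jn).
  have /andP[_ y1] := node_itv yS (jn : (j.+1 <= n.+1)%N).
  rewrite !in_itv/= => /andP[yt ty].
  by rewrite (le_trans y0 yt) (le_trans ty y1).
have [t tI mt] : exists2 t, t \in `[node y j, node y j.+1] &
    interval_max r K J y j = sum_translates r K J y t.
  apply: usc_attains_max.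
  - exact: segment_compact.
  - exists (node y j); rewrite /= in_itv/= lexx.
    by apply: (@node_mono _ _ y j j.+1) => //; rewrite leqnSn ltnS.
  - move=> t tI a ta.
    have := usc_sum_translates r_gt0 K_singular K_strictly_concave J_usc y01
      (itv_sub _ tI) (Jlty _ (itv_sub _ tI)) ta.
    rewrite !near_withinE; apply: filterS => s h sI.
    by apply: h; exact: itv_sub.
have t01 := itv_sub _ tI.
have Ft_fin : sum_translates r K J y t != -oo%E by rewrite -mt.
(* A maximum point with a finite value avoids the nodes of [y]. It also avoids
   those of [x], which lie outside the open interval of index [j] for [y]. *)
have ty i : t != y ord0 i.
  by apply: contraNneq Ft_fin => ->; apply/eqP/sum_translates_node.
have /andP[t_l t_r] : node y j <= t <= node y j.+1 by rewrite in_itv/= in tI.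
have left_nodes (i : 'I_n) : (i < j)%N -> x ord0 i < t /\ y ord0 i < t.
  move=> ij.
  have j1 : (j.-1 < n)%N by rewrite prednK ?(leq_ltn_trans _ ij)//.
  have tl : node y j < t.
    rewrite lt_neqAle t_l andbT eq_sym.
    have jE : (Ordinal j1).+1 = j by rewrite /= prednK ?(leq_ltn_trans _ ij).
    by have := ty (Ordinal j1); rewrite -node_ord jE.
  rewrite -!node_ord; split; apply: (le_lt_trans _ tl).
    by apply: le_trans node_l; apply: node_mono => //; rewrite ij leqW.
  by apply: node_mono => //; rewrite ij leqW.
have right_nodes (i : 'I_n) : (j <= i)%N -> t < x ord0 i /\ t < y ord0 i.
  move=> ji.
  have j_n : (j < n)%N by apply: leq_ltn_trans ji _.
  have tr : t < node y j.+1.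
    rewrite lt_neqAle t_r andbT -[nat_of_ord j]/(val (Ordinal j_n)).
    by rewrite node_ord ty.
  rewrite -!node_ord; split; apply: (lt_le_trans tr).
    apply: (le_trans node_r); apply: node_mono => //.
    by rewrite ltnS ji ltnS ltnW.
  by apply: node_mono => //; rewrite ltnS ji ltnS ltnW.
have diff1 (z : 'rV[R]_n) i : open_simplex z -> -1 < t - z ord0 i < 1.
  move=> [z01 _]; have := z01 i; move: t01; rewrite in_itv/=; lra.
have diff0 i : t - x ord0 i != 0 /\ t - y ord0 i != 0.
  rewrite !subr_eq0; case: (ltnP i j) => [/left_nodes|/right_nodes] [tx _].
    by rewrite ty gt_eqF.
  by rewrite ty lt_eqF.
have lt_K : \sum_i r i * K (t - y ord0 i) < \sum_i r i * K (t - x ord0 i).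
  apply: (@weighted_sum_lt _ _ j _ _ (x ord0) (y ord0)) => //.
  - by move=> i /left_nodes[? ?]; have := diff1 _ i xS; have := diff1 _ i yS;
      split; lra.
  - by move=> i /right_nodes[? ?]; have := diff1 _ i xS; have := diff1 _ i yS;
      split; lra.
  - by exists i0.
have Jt : J t \is a fin_num.
  rewrite fin_numE; apply/andP; split.
    apply: contraNneq Ft_fin => Jt.
    by rewrite /sum_translates Jt addNye.
  by rewrite lt_eqF// Jlty.
have : (sum_translates r K J y t < sum_translates r K J x t)%E.
  rewrite (sum_translatesE _ _ _ (fun i => (diff0 i).1)
    (fun i => diff1 x i xS)).
  rewrite (sum_translatesE _ _ _ (fun i => (diff0 i).2)
    (fun i => diff1 y i yS)).
  by rewrite lteD2lE// lte_fin.
rewrite ltNge => /negP; apply; rewrite -mt.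
apply: le_trans (m_le j); apply: ereal_sup_ubound; exists t => //.
by rewrite /= in_itv/= (le_trans node_l t_l) (le_trans t_r node_r).
Qed.
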